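(* Let $n\ge 2$, let $P=(p_1,\dots,p_n)$, $Q=(q_1,\dots,q_n)\in\Gamma_n$, and let $r,R$ be real numbers with $0<r\le \frac{p_i}{q_i}\le R<\infty$ for all $i\in\{1,\dots,n\}$. Then for every real $s\le 0$, $$\frac{r^{1-s}}{2(1+r)}\,\Phi_s(P\|Q)\ \le\ I(P\|Q)\ \le\ \frac{R^{1-s}}{2(1+R)}\,\Phi_s(P\|Q),$$ and for every real $s\ge 1$, $$\frac{R^{1-s}}{2(1+R)}\,\Phi_s(P\|Q)\ \le\ I(P\|Q)\ \le\ \frac{r^{1-s}}{2(1+r)}\,\Phi_s(P\|Q).$$
   Context: For $n\ge2$, $\Gamma_n=\{P=(p_1,\dots,p_n): p_i>0,\ \sum_{i=1}^n p_i=1\}$. For $P,Q\in\Gamma_n$ and $s\in\mathbb{R}$, the relative information of type $s$ is $\Phi_s(P\|Q)=[s(s-1)]^{-1}\left[\sum_{i=1}^n p_i^s q_i^{1-s}-1\right]$ for $s\ne 0,1$; $\Phi_0(P\|Q)=\sum_{i=1}^n q_i\ln\frac{q_i}{p_i}$; $\Phi_1(P\|Q)=\sum_{i=1}^n p_i\ln\frac{p_i}{q_i}$. The JS-divergence is $I(P\|Q)=\frac12\left[\sum_{i=1}^n p_i\ln\left(\frac{2p_i}{p_i+q_i}\right)+\sum_{i=1}^n q_i\ln\left(\frac{2q_i}{p_i+q_i}\right)\right]$. *)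

(* Defs.v *)
From HB Require Import structures.
From mathcomp Require Import all_boot all_order all_algebra.
From mathcomp Require Import all_classical all_reals all_analysis.

Set Implicit Arguments.
Unset Strict Implicit.
Unset Printing Implicit Defensive.

Import Order.TTheory GRing.Theory Num.Theory.

Local Open Scope ring_scope.

Definition Gamma (K : realType) (n : nat) (P : 'I_n -> K) : Prop :=
  (forall i, 0 < P i) /\ \sum_(i < n) P i = 1.

(* [powR] and [ln] are total; the weights are positive for P, Q in Gamma, where
   they are the usual real power and logarithm. *)
Definition rel_info (K : realType) (n : nat) (s : K) (P Q : 'I_n -> K) : K :=
  if s == 0 then \sum_(i < n) Q i * ln (Q i / P i)
  else if s == 1 then \sum_(i < n) P i * ln (P i / Q i)
  else (s * (s - 1))^-1 *
    ((\sum_(i < n) P i `^ s * Q i `^ (1 - s)) - 1).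

Definition JS_div (K : realType) (n : nat) (P Q : 'I_n -> K) : K :=
  2^-1 * (\sum_(i < n) P i * ln (2 * P i / (P i + Q i)) +
          \sum_(i < n) Q i * ln (2 * Q i / (P i + Q i))).

(* Main.v *)
Require Import Defs.
From HB Require Import structures.
From mathcomp Require Import all_boot all_order all_algebra.
From mathcomp Require Import all_classical all_reals all_analysis.
From mathcomp Require Import ring lra.

Set Implicit Arguments.
Unset Strict Implicit.
Unset Printing Implicit Defensive.

Import Order.TTheory GRing.Theory Num.Theory.
Import numFieldNormedType.Exports.

Local Open Scope ring_scope.

(** Both divergences are Csiszar sums [\sum_i Q i * f (P i / Q i)]: the
Jensen-Shannon divergence is generated by a function [js_gen] and the relative
information of type [s] by [info_gen s].  Each generator is normalized to vanish
together with its first derivative at 1; subtracting the tangent line at 1 does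
not change the sum, because [P] and [Q] have the same total mass.  The second
derivatives are
  [js_gen''(x) = 1 / (2 x (1 + x))]  and  [(info_gen s)''(x) = x `^ (s - 2)],
so their quotient is [x `^ (1 - s) / (2 (1 + x))], the function [curv_ratio s].
Its logarithmic derivative has the sign of [1 - s - s x], so on the positive
half-line it is increasing for [s <= 0] and decreasing for [s >= 1], and on
[`[r, R]] it lies between its values at the endpoints.

The total mass being the same, 1 lies between the smallest and the largest
ratio [P i / Q i], hence in [`[r, R]].  An inequality [f'' <= g''] between
second derivatives on [`[r, R]] therefore integrates twice from 1 to the
inequality [f <= g] on [`[r, R]] ([le_of_derive2]).  Applied to [js_gen] and
to the multiples of [info_gen s] by [curv_ratio s r] and [curv_ratio s R], and
summed with the weights [Q i], this gives the four bounds. *)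

(** * Comparing functions through their second derivatives *)

Section SecondDerivative.
Variable K : realType.
Implicit Types (f g : K -> K) (a x l u : K).

(** The mean value theorem without an order between the two endpoints; the
last conjunct says that [c] and [x] are on the same side of [a], which is all
that a second application of the theorem needs. *)
Lemma mean_value_between f f' l u a x :
  {in `[l, u], forall y : K, is_derive y 1 f (f' y)} ->
  a \in `[l, u] -> x \in `[l, u] ->
  exists c, [/\ c \in `[l, u], f x - f a = f' c * (x - a)
              & 0 <= (c - a) * (x - a)].
Proof.
move=> df.
have mvt b d : b <= d -> b \in `[l, u] -> d \in `[l, u] ->
    exists2 c, c \in `[b, d] & f d - f b = f' c * (d - b).
  move=> bd; rewrite !in_itv /= => /andP[lb _] /andP[_ du].
  have sub y : y \in `[b, d] -> y \in `[l, u].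
    by rewrite !in_itv /= => /andP[? ?]; apply/andP; split; lra.
  apply: MVT_segment => // [y ybd|].
    by apply: df; apply: sub; exact: subset_itv_oo_cc.
  apply: derivable_within_continuous => y /sub /df dfy.
  exact: ex_derive.
move=> aI xI; have [ax|/ltW xa] := leP a x.
- have [c] := mvt _ _ ax aI xI; move: aI xI; rewrite !in_itv /=.
  move=> /andP[? ?] /andP[? ?] /andP[? ?] e; exists c; split=> //.
    by rewrite in_itv /=; apply/andP; split; lra.
  by apply: mulr_ge0; lra.
- have [c] := mvt _ _ xa xI aI; move: aI xI; rewrite !in_itv /=.
  move=> /andP[? ?] /andP[? ?] /andP[? ?] e; exists c; split.
  + by rewrite in_itv /=; apply/andP; split; lra.
  + by rewrite -opprB e -mulrN opprB.
  + by rewrite -mulrNN; apply: mulr_ge0; lra.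
Qed.

(** Two applications of the mean value theorem give
[f x = f'' d * ((c - a) * (x - a))], with [c] between [a] and [x]. *)
Lemma ge0_of_derive2 f f' f'' l u a x :
  {in `[l, u], forall y : K, is_derive y 1 f (f' y)} ->
  {in `[l, u], forall y : K, is_derive y 1 f' (f'' y)} ->
  {in `[l, u], forall y, 0 <= f'' y} ->
  a \in `[l, u] -> f a = 0 -> f' a = 0 -> x \in `[l, u] -> 0 <= f x.
Proof.
move=> df df' f''0 aI fa f'a xI.
have [c [cI + cax]] := mean_value_between df aI xI.
have [d [dI + _]] := mean_value_between df' aI cI.
rewrite fa f'a !subr0 => -> ->.
by rewrite -mulrA mulr_ge0 ?f''0.
Qed.

Lemma le_of_derive2 f f' f'' g g' g'' l u a x :
  {in `[l, u], forall y : K, is_derive y 1 f (f' y)} ->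
  {in `[l, u], forall y : K, is_derive y 1 f' (f'' y)} ->
  {in `[l, u], forall y : K, is_derive y 1 g (g' y)} ->
  {in `[l, u], forall y : K, is_derive y 1 g' (g'' y)} ->
  {in `[l, u], forall y, f'' y <= g'' y} ->
  a \in `[l, u] -> f a = g a -> f' a = g' a -> x \in `[l, u] -> f x <= g x.
Proof.
move=> df df' dg dg' fg aI ea e'a xI; rewrite -subr_ge0.
apply: (@ge0_of_derive2 (g - f) (g' - f') (g'' - f'') l u a x) => //.
- by move=> y yI; apply: is_deriveB; [exact: dg|exact: df].
- by move=> y yI; apply: is_deriveB; [exact: dg'|exact: df'].
- by move=> y yI; rewrite subr_ge0 fg.
- by rewrite /= !fctE ea subrr.
- by rewrite /= !fctE e'a subrr.
Qed.

End SecondDerivative.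

(** * The generators and their derivatives *)

Section Generators.
Variable K : realType.
Implicit Types s x y : K.

(** This is [x / 2 * ln (2 x / (1 + x)) + 1 / 2 * ln (2 / (1 + x))] with the
logarithms of quotients expanded. *)
Definition js_gen x : K := 2^-1 * (x * ln x + (1 + x) * (ln 2 - ln (1 + x))).

Definition js_gen' x : K := 2^-1 * (ln x + (ln 2 - ln (1 + x))).

(** The cases 0 and 1 are the limits of the general formula. *)
Definition info_gen s x : K :=
  if s == 0 then x - 1 - ln x
  else if s == 1 then x * ln x - (x - 1)
  else (s * (s - 1))^-1 * (x `^ s - 1 - s * (x - 1)).

Definition info_gen' s x : K :=
  if s == 1 then ln x else (s - 1)^-1 * (x `^ (s - 1) - 1).

Definition curv_ratio s x : K := x `^ (1 - s) / (2 * (1 + x)).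

Lemma js_gen1 : js_gen 1 = 0.
Proof. by rewrite /js_gen ln1 subrr !mulr0 addr0 mulr0. Qed.

Lemma js_gen'1 : js_gen' 1 = 0.
Proof. by rewrite /js_gen' ln1 subrr addr0 mulr0. Qed.

Lemma info_gen1 s : info_gen s 1 = 0.
Proof.
rewrite /info_gen ln1 powR1 !subrr !mulr0 !subrr mulr0.
by case: ifP => // _; case: ifP.
Qed.

Lemma info_gen'1 s : info_gen' s 1 = 0.
Proof. by rewrite /info_gen' ln1 powR1 subrr mulr0; case: ifP. Qed.

Lemma is_derive_ln1D x : 0 < x ->
  is_derive x 1 (fun y : K => ln (1 + y)) (1 + x)^-1.
Proof.
move=> x0; have x10 : 0 < 1 + x by lra.
have dln := is_derive1_ln x10.
have d1D : is_derive x 1 (cst 1 + id : K -> K) (0 + 1) by exact: is_deriveD.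
have := @is_derive1_comp _ (@ln K) (cst 1 + id) x _ _ dln d1D.
by rewrite add0r mulr1.
Qed.

Lemma is_derive_js_gen x : 0 < x -> is_derive x 1 js_gen (js_gen' x).
Proof.
move=> x0; have x10 : 1 + x != 0 by lra.
have dln := is_derive1_ln x0; have dln1 := is_derive_ln1D x0.
have did := is_derive_id x (1 : K).
have d := is_deriveZ 2^-1 (is_deriveD (is_deriveM did dln)
  (is_deriveM (is_deriveD (is_derive_cst (1 : K) x (1 : K)) did)
     (is_deriveB (is_derive_cst (ln 2) x (1 : K)) dln1))).
apply: (is_derive_eq d); rewrite /js_gen' /GRing.scale /= !fctE.
by field; rewrite x10 gt_eqF.
Qed.

Lemma is_derive_js_gen' x : 0 < x ->
  is_derive x 1 js_gen' ((2 * x * (1 + x))^-1).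
Proof.
move=> x0; have x10 : 1 + x != 0 by lra.
have dln := is_derive1_ln x0; have dln1 := is_derive_ln1D x0.
have d := is_deriveZ 2^-1 (is_deriveD dln
     (is_deriveB (is_derive_cst (ln 2) x (1 : K)) dln1)).
apply: (is_derive_eq d); rewrite /GRing.scale /= ?fctE.
by field; rewrite x10 gt_eqF.
Qed.

Lemma is_derive_info_gen s x : 0 < x ->
  is_derive x 1 (info_gen s) (info_gen' s x).
Proof.
move=> x0; have dln := is_derive1_ln x0.
have did := is_derive_id x (1 : K).
have dB1 := is_deriveB did (is_derive_cst (1 : K) x (1 : K)).
rewrite /info_gen /info_gen'.
have [->|s0] := eqVneq s 0.
  rewrite eq_sym oner_eq0 sub0r powR_inv1 ?ltW//.
  have d := is_deriveB dB1 dln; apply: (is_derive_eq d).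
  by field; rewrite gt_eqF.
have [_|s1] := eqVneq s 1.
  have d := is_deriveB (is_deriveM did dln) dB1.
  apply: (is_derive_eq d); rewrite /GRing.scale /=.
  by field; rewrite gt_eqF.
have d := is_deriveZ (s * (s - 1))^-1 (is_deriveB
  (is_deriveB (is_derive1_powR s x0) (is_derive_cst (1 : K) x (1 : K)))
  (is_deriveZ s dB1)).
apply: (is_derive_eq d); rewrite /GRing.scale /=.
by field; rewrite s0 subr_eq0 s1.
Qed.

Lemma is_derive_info_gen' s x : 0 < x ->
  is_derive x 1 (info_gen' s) (x `^ (s - 2)).
Proof.
move=> x0; rewrite /info_gen'.
have [->|s1] := eqVneq s 1.
  have -> : 1 - 2 = -1 :> K by ring.
  by rewrite powR_inv1 ?ltW//; exact: is_derive1_ln.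
have d := is_deriveZ (s - 1)^-1
  (is_deriveB (is_derive1_powR (s - 1) x0) (is_derive_cst (1 : K) x (1 : K))).
apply: (is_derive_eq d); rewrite /GRing.scale /=.
have -> : s - 1 - 1 = s - 2 by ring.
by field; rewrite subr_eq0.
Qed.

Lemma curv_ratioE s x : 0 < x ->
  curv_ratio s x * x `^ (s - 2) = (2 * x * (1 + x))^-1.
Proof.
move=> x0; have x10 : 1 + x != 0 by lra.
rewrite /curv_ratio mulrAC -powRD; last by rewrite (gt_eqF x0) implybT.
have -> : 1 - s + (s - 2) = -1 by ring.
rewrite powR_inv1 ?ltW//.
by field; rewrite x10 gt_eqF.
Qed.

(** Write [curv_ratio s x] as [x `^ (- s) * (x / (2 (1 + x)))]: both factors
increase. *)
Lemma curv_ratio_le s x y : s <= 0 -> 0 < x -> x <= y ->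
  curv_ratio s x <= curv_ratio s y.
Proof.
move=> s0 x0 xy; have y0 : 0 < y by lra.
have split_s z : 0 < z -> curv_ratio s z = z `^ (- s) * (z / (2 * (1 + z))).
  move=> z0; rewrite /curv_ratio powRD; last by rewrite (gt_eqF z0) implybT.
  by rewrite powRr1 ?ltW// mulrA [z * _]mulrC.
rewrite !split_s//; apply: ler_pM; rewrite ?powR_ge0//.
- by rewrite divr_ge0//; lra.
- by apply: ge0_ler_powR; rewrite ?nnegrE//; lra.
- rewrite ler_pdivrMr; last lra.
  by rewrite mulrAC ler_pdivlMr; [nra|lra].
Qed.

(** For [1 <= s] the numerator decreases and the denominator increases. *)
Lemma curv_ratio_ge s x y : 1 <= s -> 0 < x -> x <= y ->
  curv_ratio s y <= curv_ratio s x.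
Proof.
move=> s1 x0 xy; have y0 : 0 < y by lra.
rewrite /curv_ratio -[1 - s]opprB !powRN.
apply: ler_pM; rewrite ?invr_ge0 ?powR_ge0//; first by lra.
  rewrite lef_pV2 ?posrE ?powR_gt0//.
  by apply: ge0_ler_powR; rewrite ?nnegrE//; lra.
by rewrite lef_pV2 ?posrE; lra.
Qed.

(** * Bounds between the generators *)

(** [js_gen'' = curv_ratio s * (info_gen s)''], so a bound on [curv_ratio s]
compares second derivatives. *)
Lemma info_gen_le_js_gen s k l u x : 0 < l -> 1 \in `[l, u] ->
  {in `[l, u], forall y, k <= curv_ratio s y} ->
  x \in `[l, u] -> k * info_gen s x <= js_gen x.
Proof.
move=> l0 I1 kle xI.
have pos y : y \in `[l, u] -> 0 < y by rewrite in_itv /= => /andP[? ?]; lra.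
apply: (@le_of_derive2 K (k \*: info_gen s) (k \*: info_gen' s)
  (fun y => k * y `^ (s - 2)) js_gen js_gen' (fun y => (2 * y * (1 + y))^-1)
  l u 1) => //.
- by move=> y /pos ?; apply: is_deriveZ; exact: is_derive_info_gen.
- by move=> y /pos ?; apply: is_deriveZ; exact: is_derive_info_gen'.
- by move=> y /pos ?; exact: is_derive_js_gen.
- by move=> y /pos ?; exact: is_derive_js_gen'.
- by move=> y yI; rewrite -(curv_ratioE s (pos _ yI)) ler_wpM2r ?powR_ge0 ?kle.
- by rewrite /= js_gen1 info_gen1 scaler0.
- by rewrite /= js_gen'1 info_gen'1 scaler0.
Qed.

Lemma js_gen_le_info_gen s k l u x : 0 < l -> 1 \in `[l, u] ->
  {in `[l, u], forall y, curv_ratio s y <= k} ->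
  x \in `[l, u] -> js_gen x <= k * info_gen s x.
Proof.
move=> l0 I1 lek xI.
have pos y : y \in `[l, u] -> 0 < y by rewrite in_itv /= => /andP[? ?]; lra.
apply: (@le_of_derive2 K js_gen js_gen' (fun y => (2 * y * (1 + y))^-1)
  (k \*: info_gen s) (k \*: info_gen' s) (fun y => k * y `^ (s - 2))
  l u 1) => //.
- by move=> y /pos ?; exact: is_derive_js_gen.
- by move=> y /pos ?; exact: is_derive_js_gen'.
- by move=> y /pos ?; apply: is_deriveZ; exact: is_derive_info_gen.
- by move=> y /pos ?; apply: is_deriveZ; exact: is_derive_info_gen'.
- by move=> y yI; rewrite -(curv_ratioE s (pos _ yI)) ler_wpM2r ?powR_ge0 ?lek.
- by rewrite /= js_gen1 info_gen1 scaler0.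
- by rewrite /= js_gen'1 info_gen'1 scaler0.
Qed.

End Generators.

(** * The divergences as Csiszar sums *)

Section CsiszarSums.
Variables (K : realType) (n : nat) (P Q : 'I_n -> K).
Hypotheses (hP : Gamma P) (hQ : Gamma Q).

Let P0 i : 0 < P i. Proof. by case: hP. Qed.
Let Q0 i : 0 < Q i. Proof. by case: hQ. Qed.

Lemma JS_divE : JS_div P Q = \sum_(i < n) Q i * js_gen (P i / Q i).
Proof.
rewrite /JS_div -big_split mulr_sumr; apply: eq_bigr => i _ /=.
have [p0 q0] := (P0 i, Q0 i); have pq0 : 0 < P i + Q i by lra.
have e1 : 1 + P i / Q i = (P i + Q i) / Q i.
  by rewrite mulrDl divff ?gt_eqF// addrC.
rewrite /js_gen e1 !ln_div ?posrE ?mulr_gt0// !lnM ?posrE//.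
by field; rewrite gt_eqF.
Qed.

(** Equal total masses make the affine part of [info_gen s] contribute 0. *)
Lemma rel_infoE s : rel_info s P Q = \sum_(i < n) Q i * info_gen s (P i / Q i).
Proof.
have [_ sP] := hP; have [_ sQ] := hQ.
rewrite /rel_info /info_gen; case: ifP => [_|s0].
  apply/eqP; rewrite -subr_eq0 -sumrB; apply/eqP.
  rewrite (eq_bigr (fun i => Q i - P i)) ?sumrB ?sP ?sQ ?subrr// => i _.
  have [p0 q0] := (P0 i, Q0 i); rewrite !ln_div ?posrE//.
  by field; rewrite gt_eqF.
case: ifP => [_|s1].
  apply/eqP; rewrite -subr_eq0 -sumrB; apply/eqP.
  rewrite (eq_bigr (fun i => P i - Q i)) ?sumrB ?sP ?sQ ?subrr// => i _.
  have [p0 q0] := (P0 i, Q0 i).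
  by field; rewrite gt_eqF.
transitivity ((s * (s - 1))^-1 * (\sum_(i < n)
    (P i `^ s * Q i `^ (1 - s) - Q i - s * (P i - Q i)))).
  by rewrite !sumrB -mulr_sumr sumrB sP sQ subrr mulr0 subr0.
rewrite mulr_sumr; apply: eq_bigr => i _.
have [p0 q0] := (P0 i, Q0 i).
rewrite powRM ?invr_ge0 ?ltW// -(powR_inv1 (ltW q0)) -powRrM mulN1r powRN.
rewrite powRB; last by rewrite (gt_eqF q0) implybT.
rewrite powRr1 ?ltW// powR_inv1 ?ltW//.
have := powR_gt0 s q0; move: (Q i `^ s) => qs qs0.
by field; rewrite subr_eq0 s0 s1 !gt_eqF.
Qed.

(** Summing [r * Q i <= P i <= R * Q i] over [i] gives [r <= 1 <= R]. *)
Lemma one_between_ratio_bounds r R :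
  (forall i, P i / Q i \in `[r, R]) -> 1 \in `[r, R].
Proof.
have [_ sP] := hP; have [_ sQ] := hQ => hrR.
rewrite in_itv /= -[r]mulr1 -[R]mulr1 -{1}sQ -[X in _ && (_ <= _ * X)]sQ -sP.
rewrite !mulr_sumr; apply/andP; split; apply: ler_sum => i _.
- by have := hrR i; rewrite in_itv /= ler_pdivlMr// => /andP[].
- by have := hrR i; rewrite in_itv /= ler_pdivrMr// => /andP[].
Qed.

Lemma rel_info_le_JS_div s k l u : 0 < l ->
  (forall i, P i / Q i \in `[l, u]) ->
  {in `[l, u], forall y, k <= curv_ratio s y} ->
  k * rel_info s P Q <= JS_div P Q.
Proof.
move=> l0 hlu kle; rewrite JS_divE rel_infoE mulr_sumr.
apply: ler_sum => i _; rewrite mulrCA; apply: ler_wpM2l; first exact: ltW.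
exact: info_gen_le_js_gen l0 (one_between_ratio_bounds hlu) kle (hlu i).
Qed.

Lemma JS_div_le_rel_info s k l u : 0 < l ->
  (forall i, P i / Q i \in `[l, u]) ->
  {in `[l, u], forall y, curv_ratio s y <= k} ->
  JS_div P Q <= k * rel_info s P Q.
Proof.
move=> l0 hlu lek; rewrite JS_divE rel_infoE mulr_sumr.
apply: ler_sum => i _; rewrite [leRHS]mulrCA.
apply: ler_wpM2l; first exact: ltW.
exact: js_gen_le_info_gen l0 (one_between_ratio_bounds hlu) lek (hlu i).
Qed.

End CsiszarSums.

Theorem theorem5p2 (K : realType) (n : nat) (P Q : 'I_n -> K) (r R : K)
  (hn : (2 <= n)%N) (hP : Gamma P) (hQ : Gamma Q) (hr : 0 < r)
  (hrR : forall i, r <= P i / Q i /\ P i / Q i <= R) :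
  (forall s : K, s <= 0 ->
     r `^ (1 - s) / (2 * (1 + r)) * rel_info s P Q <= JS_div P Q /\
     JS_div P Q <= R `^ (1 - s) / (2 * (1 + R)) * rel_info s P Q) /\
  (forall s : K, 1 <= s ->
     R `^ (1 - s) / (2 * (1 + R)) * rel_info s P Q <= JS_div P Q /\
     JS_div P Q <= r `^ (1 - s) / (2 * (1 + r)) * rel_info s P Q).
Proof.
have hI i : P i / Q i \in `[r, R].
  by have [? ?] := hrR i; rewrite in_itv /=; apply/andP.
split=> s hs; split.
- apply: (rel_info_le_JS_div hP hQ hr hI) => y; rewrite in_itv /= => /andP[? ?].
  exact: curv_ratio_le.
- apply: (JS_div_le_rel_info hP hQ hr hI) => y; rewrite in_itv /= => /andP[? ?].
  by apply: curv_ratio_le => //; lra.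
- apply: (rel_info_le_JS_div hP hQ hr hI) => y; rewrite in_itv /= => /andP[? ?].
  by apply: curv_ratio_ge => //; lra.
- apply: (JS_div_le_rel_info hP hQ hr hI) => y; rewrite in_itv /= => /andP[? ?].
  exact: curv_ratio_ge.
Qed.
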